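(* Let $R$ be a commutative ring with nonzero identity and $M$ a nonzero $R$-module. Then the trivial extension $R\ltimes M$ is a pseudo simple ring if and only if $R$ is a local ring with unique maximal ideal $\operatorname{ann}(M)$ and $\operatorname{ann}(r)=\operatorname{ann}(M)$ for all nonzero nonunit elements $r$ of $R$.
   Context: For a commutative ring $A$ with nonzero identity (not necessarily a domain), an $A$-module $N$ is called pseudo simple if the submodule $An$ is simple for every $0\neq n\in N$ with $An\neq N$. A ring $A$ is a pseudo simple ring if it is a pseudo simple module over itself. The trivial extension $R\ltimes M=R\oplus M$ is the commutative ring with componentwise addition and multiplication $(a,m)(b,n)=(ab,an+bm)$. $\operatorname{ann}(M)=\{r\in R: rM=0\}$ and, for $r\in R$, $\operatorname{ann}(r)=\{x\in R: xr=0\}$. A local ring is a commutative ring with exactly one maximal ideal. *)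

(* Defs.v *)
From HB Require Import structures.
From mathcomp Require Import all_boot all_algebra classical_sets.

Set Implicit Arguments.
Unset Strict Implicit.
Unset Printing Implicit Defensive.

Import GRing.Theory.
Local Open Scope classical_set_scope.
Local Open Scope ring_scope.

Section Modules.
Variables (A : comNzRingType) (N : lmodType A).

Definition submodule (S : set N) : Prop :=
  S 0 /\ forall (a : A) (u v : N), S u -> S v -> S (a *: u + v).

Definition cyclic_submodule (n : N) : set N := [set a *: n | a in [set: A]].

(* The submodules of the A-module S are the submodules of N contained in S,
   so S need not be turned into a module type of its own. *)
Definition simple_submodule (S : set N) : Prop :=
  [/\ submodule S, S <> [set 0] &
      forall T : set N, submodule T -> T `<=` S -> T = [set 0] \/ T = S].

Definition pseudo_simple_module : Prop :=
  forall n : N, n <> 0 -> cyclic_submodule n <> [set: N] ->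
    simple_submodule (cyclic_submodule n).

Definition ann_module : set A := [set r | forall x : N, r *: x = 0].

End Modules.

Arguments pseudo_simple_module {A} N.
Arguments ann_module {A} N.

Section Rings.
Variable A : comNzRingType.

Definition pseudo_simple_ring : Prop := pseudo_simple_module A^o.

Definition ideal (I : set A) : Prop := @submodule A A^o I.

Definition maximal_ideal (I : set A) : Prop :=
  [/\ ideal I, I <> [set: A] &
      forall J : set A, ideal J -> I `<=` J -> J = I \/ J = [set: A]].

Definition local_ring : Prop := exists! I : set A, maximal_ideal I.

Definition ann_elt (r : A) : set A := [set x | x * r = 0].

(* A comNzRingType carries no [GRing.unit] predicate. *)
Definition invertible (r : A) : Prop := exists s : A, r * s = 1.

End Rings.

Arguments pseudo_simple_ring : clear implicits.
Arguments local_ring : clear implicits.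

(* An alias of the product type, so that its ring structure is kept apart from
   the componentwise one. *)
Definition trivial_ext (R : comNzRingType) (M : lmodType R) : Type :=
  (R * M)%type.

Section TrivialExtension.
Variables (R : comNzRingType) (M : lmodType R).
Local Notation E := (trivial_ext M).

HB.instance Definition _ := GRing.Zmodule.copy E (R * M)%type.

Definition te_one : E := (1, 0).
Definition te_mul (x y : E) : E := (x.1 * y.1, x.1 *: y.2 + y.1 *: x.2).

Fact te_mulA : associative te_mul.
Proof.
move=> [a m] [b n] [c p]; rewrite /te_mul /= mulrA; congr pair.
by rewrite !scalerDr !scalerA addrA (mulrC c a) (mulrC c b).
Qed.

Fact te_mulC : commutative te_mul.
Proof. by move=> [a m] [b n]; rewrite /te_mul /= mulrC addrC. Qed.

Fact te_mul1 : left_id te_one te_mul.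
Proof. by move=> [a m]; rewrite /te_mul /= mul1r scale1r scaler0 addr0. Qed.

Fact te_mulDl : left_distributive te_mul +%R.
Proof.
move=> [a m] [b n] [c p]; rewrite /te_mul /=; congr pair; first exact: mulrDl.
by rewrite scalerDl scalerDr addrACA.
Qed.

Fact te_one_neq0 : te_one != 0.
Proof. by rewrite xpair_eqE oner_eq0. Qed.

HB.instance Definition _ := GRing.Zmodule_isComNzRing.Build E
  te_mulA te_mulC te_mul1 te_mulDl te_one_neq0.

End TrivialExtension.

(* Main.v *)
Require Import Defs.
From mathcomp Require Import all_boot all_algebra classical_sets.
From mathcomp Require Import boolp.
Import GRing.Theory.
Local Open Scope ring_scope.

(** A ring is pseudo simple iff every nonzero multiple [a n] of a nonzero
    nonunit [n] can be multiplied back to [n], and [(r, m)] is a unit of the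
    trivial extension iff [r] is one of [R].

    If the extension is pseudo simple and [r] is a nonzero nonunit with
    [r m <> 0], then [(0, r m)] is a nonzero multiple of [(r, 0)] that cannot be
    multiplied back; hence [ann M] is the set of nonunits.  If [x] is in [ann M]
    and [x r <> 0], then [r = c x r] for some [c], so [1 - c x] kills [r] and
    is a nonunit, i.e. lies in [ann M] together with [x], which is absurd.

    Conversely, once the nonunits are the elements of [ann M], multiplying
    [(r, m)], where [r] is a nonunit, by [(b, k)] gives [(b r, b m)]: this is [0]
    when [b] is in [ann M], and otherwise [b] is a unit. *)

Section CommutativeRing.
Variable A : comNzRingType.

Lemma ideal_invertible (I : set A) (u : A) :
  ideal I -> I u -> invertible u -> I = [set: A]%classic.
Proof.
move=> [I0 Ilin] Iu [v uv1]; apply/seteqP; split=> // a _.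
have := Ilin (a * v) u 0 Iu I0.
by rewrite addr0 /GRing.scale /= -mulrA (mulrC v) uv1 mulr1.
Qed.

Lemma invertible_mull (a u : A) : invertible (a * u) -> invertible u.
Proof. by case=> v auv1; exists (a * v); rewrite mulrA (mulrC u). Qed.

Lemma invertible_mul0 (u r : A) : invertible u -> u * r = 0 -> r = 0.
Proof.
by move=> [v uv1] ur0; rewrite -[r]mul1r -uv1 (mulrC u) -mulrA ur0 mulr0.
Qed.

Lemma submodule_cyclic (N : lmodType A) (n : N) :
  submodule (cyclic_submodule n).
Proof.
split; first by exists 0; rewrite ?scale0r.
by move=> a _ _ [b _ <-] [c _ <-]; exists (a * b + c); rewrite // scalerDl scalerA.
Qed.

(** A nonzero submodule of [A n] contains some nonzero [a n], so it is all of [A n] as soon as [n]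
    is a multiple of [a n]. *)
Lemma simple_cyclic_submoduleP (N : lmodType A) (n : N) : n <> 0 ->
  simple_submodule (cyclic_submodule n) <->
  forall a : A, a *: n <> 0 -> exists c : A, c *: (a *: n) = n.
Proof.
move=> n0; have nn : cyclic_submodule n n by exists 1; rewrite ?scale1r.
split=> [[_ _ simple_n] a an0 | back].
  case: (simple_n (cyclic_submodule (a *: n))).
  - exact: submodule_cyclic.
  - by move=> _ [b _ <-]; exists (b * a); rewrite ?scalerA.
  - move=> an_eq0; case: an0.
    suff: [set 0 : N]%classic (a *: n) by [].
    by rewrite -an_eq0; exists 1; rewrite ?scale1r.
  - by move=> an_eqn; move: nn; rewrite -an_eqn => -[c _ ?]; exists c.
split; first exact: submodule_cyclic.
  by move=> eq0; apply: n0; move: nn; rewrite eq0.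
move=> T [T0 Tlin] Tn.
have [T_eq0|] := EM (T `<=` [set 0])%classic.
  by left; apply/seteqP; split=> // _ ->.
move=> /existsNP[t /not_implyP[Tt t0]]; right; apply/seteqP; split=> //.
have [a _ an_t] := Tn _ Tt.
have [|c can] := back a; first by rewrite an_t.
move=> _ [b _ <-]; rewrite -can an_t scalerA.
by have := Tlin (b * c) t 0 Tt T0; rewrite addr0.
Qed.

Lemma cyclic_submodule_regular (n : A) :
  @cyclic_submodule A A^o n = [set: A]%classic <-> invertible n.
Proof.
split=> [n_eqT | [s ns1]].
  have : @cyclic_submodule A A^o n 1 by rewrite n_eqT.
  by case=> s _ sn1; exists s; rewrite mulrC.
apply/seteqP; split=> // a _; exists (a * s) => //.
by rewrite /GRing.scale /= -mulrA (mulrC s) ns1 mulr1.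
Qed.

Lemma pseudo_simple_ringP :
  pseudo_simple_ring A <->
  forall n : A, n <> 0 -> ~ invertible n ->
  forall a : A, a * n <> 0 -> exists c : A, c * (a * n) = n.
Proof.
split=> ps n n0 nn.
  apply/(simple_cyclic_submoduleP A^o _ n0); apply: ps => //.
  by move=> /cyclic_submodule_regular.
apply/(simple_cyclic_submoduleP A^o _ n0); apply: ps => //.
by move=> /cyclic_submodule_regular.
Qed.

Lemma nonunits_maximal (I : set A) :
  ideal I -> (forall r : A, I r <-> ~ invertible r) -> maximal_ideal I.
Proof.
move=> idI IP; split=> //.
  move=> I_eqT; have /IP[] : I 1 by rewrite I_eqT.
  by exists 1; rewrite mulr1.
move=> J idJ IJ; have [JI|] := EM (J `<=` I)%classic.
  by left; apply/seteqP; split.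
move=> /existsNP[u /not_implyP[Ju nIu]]; right.
by apply: (ideal_invertible _ _ idJ Ju); apply: contrapT => /IP.
Qed.

(** A proper ideal contains no unit, so every maximal ideal lies in [I], and its maximality forces
    equality. *)
Lemma nonunits_local (I : set A) :
  ideal I -> (forall r : A, I r <-> ~ invertible r) -> local_ring A.
Proof.
move=> idI IP; have maxI := nonunits_maximal _ idI IP.
exists I; split=> // J [idJ JT maxJ].
have [|//|I_eqT] := maxJ I idI.
  by move=> u Ju; apply/IP => /(ideal_invertible _ _ idJ Ju).
by case: maxI.
Qed.

Lemma ideal_ann (N : lmodType A) : ideal (ann_module N).
Proof.
split=> [x | a u v uN vN x]; first exact: scale0r.
by rewrite -[a *: _]/(a * u) scalerDl -scalerA uN vN scaler0 addr0.
Qed.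

Lemma maximal_ideal_comax (I : set A) (r : A) :
  maximal_ideal I -> ~ I r -> exists a : A, I (1 - a * r).
Proof.
move=> [[I0 Ilin] _ maxI] nIr.
(* [J] is the ideal [I + A r]. It contains [r], so it differs from [I], and maximality puts [1] in
   it. *)
pose J : set A := [set x | exists a : A, I (x - a * r)]%classic.
have idJ : ideal J.
  split=> [|b u v [a Iu] [c Iv]]; first by exists 0; rewrite mul0r subr0.
  exists (b * a + c); have := Ilin b _ _ Iu Iv; rewrite /GRing.scale /=.
  by rewrite mulrBr mulrDl opprD addrACA mulrA.
have IJ : (I `<=` J)%classic by move=> x Ix; exists 0; rewrite mul0r subr0.
have [JI|JT] := maxI J idJ IJ; last by have : J 1 by rewrite JT.
by case: nIr; rewrite -JI; exists 1; rewrite mul1r subrr.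
Qed.

(* If [r] is a nonunit outside [ann N], then [1 - a r] lies in [ann N = ann r]
   for some [a], so that [e = a r] is idempotent; then [e] and [1 - e] are both
   nonzero nonunits, with the same annihilator, which therefore contains [1]. *)
Lemma ann_eq_nonunits (N : lmodType A) :
  maximal_ideal (ann_module N) ->
  (forall r : A, r <> 0 -> ~ invertible r -> ann_elt r = ann_module N) ->
  forall r : A, ann_module N r <-> ~ invertible r.
Proof.
move=> maxI annE r; have [idI IT _] := maxI; split=> [Ir | nr].
  by move=> /(ideal_invertible _ _ idI Ir).
apply: contrapT => nIr.
have r0 : r <> 0 by move=> r0; apply: nIr; rewrite r0; case: idI.
have [a Iar] := maximal_ideal_comax _ _ maxI nIr.
set e := a * r in Iar.
have er : (1 - e) * r = 0.
  by move: Iar; rewrite -(annE r).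
have ee : (1 - e) * e = 0 by rewrite /e mulrCA er mulr0.
have ne : ~ invertible e by move/invertible_mull.
have ne1 : ~ invertible (1 - e) by move/(ideal_invertible _ _ idI Iar).
have e1 : 1 - e <> 0.
  by move/subr0_eq => e1; apply: ne; rewrite -e1; exists 1; rewrite mulr1.
have Ie : ann_module N e.
  by rewrite -(annE (1 - e)) // /ann_elt /= mulrC.
apply: IT; apply: (ideal_invertible _ 1 idI); last by exists 1; rewrite mulr1.
have := proj2 idI 1 _ _ Iar Ie.
by rewrite scale1r subrK.
Qed.

End CommutativeRing.

Section TrivialExtension.
Variables (R : comNzRingType) (M : lmodType R).
Local Notation E := (trivial_ext M).

Lemma te_mulE (x y : E) :
  x * y = (x.1 * y.1, x.1 *: y.2 + y.1 *: x.2) :> E.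
Proof. by []. Qed.

Lemma te_invertible (x : E) : invertible x <-> invertible x.1.
Proof.
split=> [[y] | [s rs1]].
  by rewrite te_mulE => -[xy1 _]; exists y.1.
(* The second coordinate [y] of the inverse solves [x.1 y + s x.2 = 0]; multiplying by [s] gives
   [y = - s^2 x.2]. *)
exists ((s, - (s * s) *: x.2) : E); rewrite te_mulE /= rs1 scalerA.
by rewrite mulrN mulrA rs1 mul1r scaleNr addNr.
Qed.

Lemma te_pseudo_simple_ann (r : R) :
  pseudo_simple_ring E -> r <> 0 -> ~ invertible r -> ann_module M r.
Proof.
move=> /pseudo_simple_ringP ps r0 nr m; apply: contrapT => rm0.
have [|||c] := ps ((r, 0) : E) _ _ ((0, m) : E).
- by case.
- by move/te_invertible.
- by rewrite te_mulE /= mul0r scaler0 add0r => -[].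
by rewrite !te_mulE /= mul0r mulr0 => -[/esym].
Qed.

End TrivialExtension.

Theorem theorem11 (R : comNzRingType) (M : lmodType R)
    (M_nonzero : exists x : M, x <> 0) :
  pseudo_simple_ring (trivial_ext M) <->
  [/\ local_ring R,
      maximal_ideal (ann_module M) &
      forall r : R, r <> 0 -> ~ invertible r -> ann_elt r = ann_module M].
Proof.
have idI := ideal_ann _ M.
have I1 : ~ ann_module M 1.
  by case: M_nonzero => x x0 I1; apply: x0; rewrite -[x]scale1r I1.
split=> [ps | [_ maxI annE]].
  have IP (r : R) : ann_module M r <-> ~ invertible r.
    split=> [Ir /(ideal_invertible _ _ _ idI Ir) IT | nr].
      by apply: I1; rewrite IT.
    have [->|r0] := EM (r = 0); first by case: idI.
    exact: te_pseudo_simple_ann.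
  split; [exact: nonunits_local idI IP | exact: nonunits_maximal | ].
  move=> r r0 nr; apply/seteqP; split=> x.
    by move=> xr0; apply/IP => /invertible_mul0/(_ xr0).
  move=> Ix; apply: contrapT => xr0.
  have [|||c] := (pseudo_simple_ringP _).1 ps ((r, 0) : trivial_ext M) _ _
                    ((x, 0) : trivial_ext M).
  - by case.
  - by move/te_invertible.
  - by rewrite te_mulE /= => -[].
  rewrite !te_mulE /= => -[cxr _].
  have Icx : ann_module M (1 - c.1 * x).
    apply/IP => /invertible_mul0/(_ _)/r0; apply.
    by rewrite mulrBl mul1r -mulrA cxr subrr.
  (* The combination [c.1 x + (1 - c.1 x)] puts [1] in [ann M], against [I1]. *)
  have := proj2 idI c.1 _ _ Ix Icx.
  by rewrite /GRing.scale /= addrC subrK.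
have IP := ann_eq_nonunits _ _ maxI annE.
apply/pseudo_simple_ringP => -[r m] _ nn [b k].
have nr : ~ invertible r by move/te_invertible: nn.
have rM : ann_module M r by apply/IP.
(* As [r] kills [M], the term [r k] vanishes and the product is [(b r, b m)]. *)
rewrite te_mulE /= rM addr0 => bn0.
have [[s bs1] | nb] := EM (invertible b).
  exists ((s, 0) : trivial_ext M); rewrite te_mulE /= scaler0 addr0.
  by rewrite mulrA scalerA (mulrC s) bs1 mul1r scale1r.
have bM : ann_module M b by apply/IP.
case: bn0; rewrite bM; congr pair.
(* The hypothesis [annE] covers only nonzero [r]; there [b] in [ann M = ann r] gives [b r = 0]. *)
have [->|r0] := EM (r = 0); first exact: mulr0.
by move: bM; rewrite -(annE r).
Qed.
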